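(* Let $\sigma:\{\pm1\}^d\to[0,1]$ satisfy $\sigma(\mathbf{g})=\sigma(-\mathbf{g})$ and $\mathbf{E}_{\mathbf{g}\sim\mathsf{Unif}(\{\pm1\}^d)}[\sigma(\mathbf{g})]=p\in(0,1)$. Then, with an absolute implied constant, $$\mathsf{TV}\Big(\mathsf{RAG}(n,\{\pm1\}^d,\sigma,p),\ \mathsf{G}(n,p)\Big)^2 = O\!\left(\frac{n^3\sum_{i=1}^d\mathbf{Inf}_i[\sigma]^2}{p^2(1-p)^2}\right).$$
   Context: $\mathsf{RAG}(n,\{\pm1\}^d,\sigma,p)$ is the random graph on $[n]$ obtained by sampling $\mathbf{x}^1,\dots,\mathbf{x}^n$ iid uniform on the group $\{\pm1\}^d$ (coordinatewise multiplication) and, conditionally on them, including each edge $ij$ independently with probability $\sigma(\mathbf{x}^i\cdot\mathbf{x}^j)$ (the group ''difference'', here the coordinatewise product). $\mathsf{G}(n,p)$ is Erdős–Rényi. For $f:\{\pm1\}^d\to\mathbb{R}$, the influence of coordinate $i$ is $\mathbf{Inf}_i[f]=\mathbf{E}_{\mathbf{x}}[(f(\mathbf{x})-f(\mathbf{x}^{\oplus i}))^2/4]=\sum_{S\ni i}\hat f(S)^2$, where $\mathbf{x}^{\oplus i}$ is $\mathbf{x}$ with the $i$-th coordinate flipped and $\hat f(S)$ are the Fourier–Walsh coefficients. *)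

(* Defs.v *)
From HB Require Import structures.
From mathcomp Require Import all_boot all_order all_algebra.
From mathcomp Require Import reals.
Set Implicit Arguments. Unset Strict Implicit. Unset Printing Implicit Defensive.
Import Order.TTheory GRing.Theory Num.Theory.
Local Open Scope ring_scope.

(* The hypercube {±1}^d, encoded as bit vectors: bit b <-> (-1)^b.
   Coordinatewise multiplication of ±1 vectors is coordinatewise xor. *)
Definition cube (d : nat) := {ffun 'I_d -> bool}.

Definition cmul (d : nat) (x y : cube d) : cube d := [ffun i => x i (+) y i].
Definition cneg (d : nat) (x : cube d) : cube d := [ffun i => ~~ x i].
Definition cflip (d : nat) (i : 'I_d) (x : cube d) : cube d :=
  [ffun j => if j == i then ~~ x j else x j].

Definition Ecube (R : realType) (d : nat) (f : cube d -> R) : R :=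
  (2 ^+ d)^-1 * \sum_(x : cube d) f x.

Definition Inf (R : realType) (d : nat) (f : cube d -> R) (i : 'I_d) : R :=
  Ecube (fun x => (f x - f (cflip i x)) ^+ 2 / 4).

(* unordered pairs {i,j} of [n], encoded as i < j; a graph is an edge indicator *)
Definition edge (n : nat) := {e : 'I_n * 'I_n | (e.1 < e.2)%N}.
Definition graph (n : nat) := {ffun edge n -> bool}.

Definition bern (R : realType) (q : R) (b : bool) : R := if b then q else 1 - q.

Definition ER_pmf (R : realType) (n : nat) (p : R) (G : graph n) : R :=
  \prod_(e : edge n) bern p (G e).

Definition RAG_pmf (R : realType) (n d : nat) (sigma : cube d -> R)
    (G : graph n) : R :=
  ((2 ^+ d) ^+ n)^-1 *
  \sum_(xs : {ffun 'I_n -> cube d})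
     \prod_(e : edge n) bern (sigma (cmul (xs (val e).1) (xs (val e).2))) (G e).

Definition TV (R : realType) (n : nat) (P Q : graph n -> R) : R :=
  2^-1 * \sum_(G : graph n) `|P G - Q G|.

(* Main.v *)
Require Import Defs.
From HB Require Import structures.
From mathcomp Require Import all_boot all_order all_algebra.
From mathcomp Require Import reals sequences exp.
From mathcomp Require Import ring lra.
Set Implicit Arguments. Unset Strict Implicit. Unset Printing Implicit Defensive.
Import Order.TTheory GRing.Theory Num.Theory.
Local Open Scope ring_scope.

(* Reveal the vertices one at a time and let [L_k] be the likelihood ratio,
   against G(n, p), of the first [k] rows of the graph. The chain rule for
   relative entropy, [ln t <= e^{-a} t + a - 1] and Cauchy-Schwarz (conditioning
   on the points already placed) bound the entropy increment of row [k] by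
   [ln E (1 + gamma(g) / s)^k <= ln E exp (k gamma(g) / s)], where
   [s = p (1 - p)] and [gamma(g) = E_z (sigma(z) - p) (sigma(z g) - p)].
   Flipping coordinate [i] changes [gamma] by at most [2 Inf_i], and [gamma]
   has mean zero, so a bounded-difference estimate on the cube bounds the
   increment by [2 (k / s)^2 sum_i Inf_i^2]. Summing over [k < n] and comparing
   total variation with entropy through the Hellinger distance gives the
   constant [2]. *)

(** * Uniform averages over finite types *)

Definition avg {R : realType} {T : finType} (f : T -> R) : R :=
  #|T|%:R^-1 * \sum_x f x.

Section Avg.
Context {R : realType} {T : finType}.
Implicit Types f g : T -> R.

Lemma eq_avg f g : f =1 g -> avg f = avg g.
Proof. by move=> fg; rewrite /avg; congr (_ * _); apply: eq_bigr. Qed.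

Lemma le_avg f g : (forall x, f x <= g x) -> avg f <= avg g.
Proof.
by move=> fg; rewrite ler_wpM2l ?invr_ge0 ?ler0n//; apply: ler_sum.
Qed.

Lemma avg_ge0 f : (forall x, 0 <= f x) -> 0 <= avg f.
Proof. by move=> f0; rewrite mulr_ge0 ?invr_ge0 ?ler0n// sumr_ge0. Qed.

Lemma avgD f g : avg (fun x => f x + g x) = avg f + avg g.
Proof. by rewrite /avg big_split mulrDr. Qed.

Lemma avgZl (c : R) f : avg (fun x => c * f x) = c * avg f.
Proof. by rewrite /avg -mulr_sumr mulrCA. Qed.

Lemma avgN f : avg (fun x => - f x) = - avg f.
Proof. by rewrite /avg sumrN mulrN. Qed.

Lemma avgB f g : avg (fun x => f x - g x) = avg f - avg g.
Proof. by rewrite avgD avgN. Qed.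

Lemma avg_cst (c : R) : (0 < #|T|)%N -> avg (fun _ : T => c) = c.
Proof.
move=> T0; rewrite /avg sumr_const -[c *+ _]mulr_natl mulKf//.
by rewrite pnatr_eq0 -lt0n.
Qed.

Lemma avg_inj f (h : T -> T) : injective h -> avg (f \o h) = avg f.
Proof. by move=> hI; rewrite /avg [in RHS](reindex_inj hI). Qed.

Lemma avg_sum (I : finType) (w : I -> T -> R) :
  \sum_i avg (w i) = avg (fun x => \sum_i w i x).
Proof. by rewrite /avg exchange_big mulr_sumr. Qed.

(** Cauchy-Schwarz for the measure with density [f]; the weight will be the likelihood ratio of the
    rows already revealed. *)
Lemma sqr_avgM_le f g : (forall x, 0 <= f x) ->
  avg (fun x => f x * g x) ^+ 2 <= avg f * avg (fun x => f x * g x ^+ 2).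
Proof.
move=> f0; rewrite /avg exprMn [leRHS]mulrACA -expr2 ler_wpM2l ?sqr_ge0//.
set A := \sum_x f x; set B := \sum_x f x * g x; set C := \sum_x _ * _ ^+ 2.
(* The quadratic [t |-> sum f (t g - s)^2] is nonnegative. *)
have quad t s : 0 <= t ^+ 2 * C - 2 * t * s * B + s ^+ 2 * A.
  have -> : t ^+ 2 * C - 2 * t * s * B + s ^+ 2 * A
          = \sum_x f x * (t * g x - s) ^+ 2.
    rewrite /A /B /C !mulr_sumr -sumrB -big_split /=.
    by apply: eq_bigr => x _; ring.
  by apply: sumr_ge0 => x _; rewrite mulr_ge0 ?sqr_ge0.
have A0 : 0 <= A by apply: sumr_ge0.
have C0 : 0 <= C by apply: sumr_ge0 => x _; rewrite mulr_ge0 ?sqr_ge0.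
have [A_eq0|A_neq0] := eqVneq A 0.
  have f_eq0 x : f x = 0.
    have /eqP := A_eq0; rewrite psumr_eq0// => /allP/(_ x).
    by rewrite mem_index_enum => /(_ isT)/eqP.
  rewrite (_ : B = 0) ?expr0n ?mulr_ge0//.
  by apply: big1 => x _; rewrite f_eq0 mul0r.
have A1 : 0 < A by rewrite lt_def A_neq0.
(* With [t = A] and [s = B] the quadratic collapses to [A * (A * C - B ^+ 2)]. *)
have := quad A B.
rewrite (_ : _ + _ = A * (A * C - B ^+ 2)); last by ring.
by rewrite pmulr_rge0// subr_ge0.
Qed.

End Avg.

Lemma avg_exchange {R : realType} {S T : finType} (f : S -> T -> R) :
  avg (fun x => avg (f x)) = avg (fun y => avg (fun x => f x y)).
Proof.
rewrite /avg -!mulr_sumr !mulrA [X in X * _]mulrC; congr (_ * _).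
exact: exchange_big.
Qed.

Lemma avg_prod {R : realType} {I T : finType} (f : I -> T -> R) :
  avg (fun x : {ffun I -> T} => \prod_i f i (x i)) = \prod_i avg (f i).
Proof.
rewrite /avg -(bigA_distr_bigA f) big_split /=; congr (_ * _).
by rewrite prodr_const card_ffun natrX exprVn.
Qed.

Definition upd {I T : finType} (x : {ffun I -> T}) (k : I) (z : T)
  : {ffun I -> T} := [ffun i => if i == k then z else x i].

(** Resampling one coordinate preserves the uniform law: exchanging the fresh value [z] with the old
    value of [x k] is an involution on pairs. *)
Lemma avg_upd {R : realType} {I T : finType} (k : I) (f : {ffun I -> T} -> R) :
  (0 < #|T|)%N -> avg f = avg (fun x => avg (fun z => f (upd x k z))).
Proof.
move=> T0; transitivity (avg (fun x => avg (fun _ : T => f x))).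
  by apply: eq_avg => x; rewrite avg_cst.
rewrite /avg -!mulr_sumr !mulrA; congr (_ * _); rewrite !pair_bigA /=.
pose h (u : {ffun I -> T} * T) := (upd u.1 k u.2, u.1 k).
have hK : involutive h.
  move=> [x z]; rewrite /h /= ffunE eqxx; congr (_, _).
  by apply/ffunP => i; rewrite !ffunE; case: eqP => // ->.
by rewrite (reindex_inj (inv_inj hK)).
Qed.

(** Functions of disjoint sets of coordinates are independent. Swapping the [B]-coordinates of two
    independent copies [x], [y] turns [f x * g y] into [f y * g y]. *)
Lemma sum_indep {R : realType} {I T : finType} (B : pred I)
    (f g : {ffun I -> T} -> R) :
    (forall x y : {ffun I -> T}, (forall i, B i -> x i = y i) -> f x = f y) ->
    (forall x y : {ffun I -> T}, (forall i, ~~ B i -> x i = y i) -> g x = g y) ->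
  #|{ffun I -> T}|%:R * \sum_x f x * g x = (\sum_x f x) * \sum_x g x.
Proof.
move=> fB gB.
pose mix (x y : {ffun I -> T}) : {ffun I -> T} :=
  [ffun i => if B i then y i else x i].
pose h u := (mix u.1 u.2, mix u.2 u.1).
have hK : involutive h.
  move=> [x y]; rewrite /h /=; congr (_, _); apply/ffunP => i;
  by rewrite !ffunE; case: (B i).
transitivity (\sum_(x : {ffun I -> T}) \sum_y f y * g y).
  by rewrite sumr_const mulr_natl.
rewrite mulr_suml; under [RHS]eq_bigr do rewrite mulr_sumr.
rewrite !pair_bigA /= [RHS](reindex_inj (inv_inj hK)) /=.
apply: eq_bigr => -[x y] _ /=; congr (_ * _); first apply: fB => i Bi.
  by rewrite ffunE Bi.
by apply: gB => i /negbTE Bi; rewrite ffunE Bi.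
Qed.

(** * Elementary inequalities for the exponential and the logarithm *)

Section ExpLog.
Context {R : realType}.
Implicit Types t x y : R.

(** The constant 2 is not sharp, which allows a short proof. For [t >= 1/2] the left side is at most
    [expR t], and [t <= 2 * t ^+ 2]. For smaller [t], [expR x <= (1 - x)^-1] at [t] and [- t] gives
    the bound [(1 - t ^+ 2)^-1 <= 1 + 2 * t ^+ 2]. *)
Lemma cosh_le_expR t : (expR t + expR (- t)) / 2 <= expR (2 * t ^+ 2).
Proof.
wlog t0 : t / 0 <= t.
  move=> H; have [/H//|/ltW t0] := leP 0 t.
  by rewrite -[t in expR t]opprK addrC -sqrrN H// oppr_ge0.
have [t1|t1] := leP (2^-1) t.
  apply: (@le_trans _ _ (expR t)).
    have : expR (- t) <= expR t by rewrite ler_expR; lra.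
    lra.
  by rewrite ler_expR; nra.
have ubE x : x < 1 -> expR x <= (1 - x)^-1.
  move=> x1; rewrite -[x in expR x]opprK expRN lef_pV2 ?posrE ?expR_gt0 ?subr_gt0//.
  exact: expR_ge1Dx.
apply: le_trans (expR_ge1Dx _).
have := ubE t; have := ubE (- t); rewrite opprK => /(_ ltac:(lra)) H1 /(_ ltac:(lra)) H2.
apply: (@le_trans _ _ ((1 - t ^+ 2)^-1)).
  have -> : (1 - t ^+ 2)^-1 = ((1 + t)^-1 + (1 - t)^-1) / 2.
    by field; rewrite !lt0r_neq0//; nra.
  lra.
have u : t ^+ 2 <= 2^-1 by nra.
rewrite -[leLHS]mul1r ler_pdivrMr; last by lra.
have := sqr_ge0 t; nra.
Qed.

(** By concavity [ln] lies below its tangent at [expR a]. The right side is affine in [x], so it can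
    be averaged without Jensen's inequality. *)
Lemma ln_le_expR x a : 0 < x -> ln x <= expR (- a) * x + a - 1.
Proof.
move=> x0; have := le_ln1Dx (x := expR (- a) * x - 1).
rewrite addrCA subrr addr0 lnM ?posrE ?expR_gt0// expRK.
have : 0 < expR (- a) * x by rewrite mulr_gt0 ?expR_gt0.
move=> H /(_ ltac:(lra)); lra.
Qed.

(** Apply [ln u <= u - 1] at [u = s^-1] with [s] the square root of [x], and multiply by
    [2 * s ^+ 2]. This is the pointwise comparison of Hellinger distance with entropy. *)
Lemma sub_sqrt_le_mul_ln x : 0 <= x -> 2 * (x - Num.sqrt x) <= x * ln x.
Proof.
rewrite le_eqVlt => /predU1P[<-|x0]; first by rewrite sqrtr0 subrr mulr0 mul0r.
set s := Num.sqrt x; have s0 : 0 < s by rewrite sqrtr_gt0.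
have xE : x = s ^+ 2 by rewrite sqr_sqrtr// ltW.
have := ln_le_expR (x := s^-1) 0; rewrite invr_gt0 oppr0 expR0 mul1r addr0 lnV ?posrE// => /(_ s0) H.
rewrite xE lnXn// -mulr_natl.
have : s ^+ 2 * (1 - s^-1) <= s ^+ 2 * ln s by rewrite ler_wpM2l ?sqr_ge0//; lra.
have -> : s ^+ 2 * (1 - s^-1) = s ^+ 2 - s by field; rewrite gt_eqF.
lra.
Qed.

End ExpLog.

(** * Group structure, concentration and autocorrelation on the cube *)

Section Cube.
Context {R : realType} {d : nat}.
Implicit Types (x y z : cube d) (i j : 'I_d) (f h : cube d -> R).

Lemma card_cube : #|{: cube d}| = (2 ^ d)%N.
Proof. by rewrite card_ffun card_bool card_ord. Qed.

Lemma card_cube_gt0 : (0 < #|{: cube d}|)%N.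
Proof. by rewrite card_cube expn_gt0. Qed.

Lemma EcubeE f : Ecube f = avg f.
Proof. by rewrite /Ecube /avg card_cube natrX. Qed.

Lemma cmulC x y : cmul x y = cmul y x.
Proof. by apply/ffunP => i; rewrite !ffunE addbC. Qed.

Lemma cmulA x y z : cmul x (cmul y z) = cmul (cmul x y) z.
Proof. by apply/ffunP => i; rewrite !ffunE addbA. Qed.

Lemma cmulK x : involutive (cmul x).
Proof. by move=> y; apply/ffunP => i; rewrite !ffunE addKb. Qed.

Lemma cmulKr x : involutive (fun y => cmul y x).
Proof. by move=> y; rewrite /= ![cmul _ x]cmulC cmulK. Qed.

Lemma cflipK i : involutive (cflip i).
Proof. by move=> x; apply/ffunP => j; rewrite !ffunE; case: eqP => // _; rewrite negbK. Qed.

Lemma cflipC i j x : cflip i (cflip j x) = cflip j (cflip i x).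
Proof. by apply/ffunP => k; rewrite !ffunE; do 2 case: eqP. Qed.

Lemma cmul_cflipr i x y : cmul x (cflip i y) = cflip i (cmul x y).
Proof. by apply/ffunP => k; rewrite !ffunE; case: eqP => // _; rewrite addbN. Qed.

Lemma cmul_cflipl i x y : cmul (cflip i x) y = cflip i (cmul x y).
Proof. by rewrite cmulC cmul_cflipr cmulC. Qed.

Lemma avg_cflip i f : avg (fun x => f (cflip i x)) = avg f.
Proof. exact: (avg_inj f (inv_inj (cflipK i))). Qed.

Lemma avg_cmul x f : avg (fun y => f (cmul x y)) = avg f.
Proof. exact: (avg_inj f (inv_inj (cmulK x))). Qed.

Lemma avg_cmulr x f : avg (fun y => f (cmul y x)) = avg f.
Proof. exact: (avg_inj f (inv_inj (cmulKr x))). Qed.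

Lemma cflip_invariant_cst h :
  (forall i x, h (cflip i x) = h x) -> forall x y, h x = h y.
Proof.
move=> hI x y.
(* Walk from [x] to [y] one coordinate at a time; each step is either trivial or a flip. *)
pose mix k : cube d := [ffun i : 'I_d => if (i < k)%N then y i else x i].
have mixE k : h (mix k) = h x.
  elim: k => [|k IHk]; first by congr h; apply/ffunP => i; rewrite ffunE.
  rewrite -IHk; have [kd|dk] := ltnP k d; last first.
    congr h; apply/ffunP => i; rewrite !ffunE.
    by rewrite (leq_trans (ltn_ord i) dk) (leq_trans (ltn_ord i) (leqW dk)).
  pose k' := Ordinal kd.
  have [xy|xy] := eqVneq (x k') (y k').
    congr h; apply/ffunP => i; rewrite !ffunE ltnS leq_eqVlt.
    have [ik|//] := eqVneq (i : nat) k.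
    by rewrite (_ : i = k') ?xy ?ltnn//; apply: val_inj.
  rewrite -[RHS](hI k'); congr h; apply/ffunP => i.
  rewrite !ffunE ltnS leq_eqVlt -val_eqE /=.
  have [ik|//] := eqVneq (i : nat) k.
  rewrite (_ : i = k') ?ltnn /=; last exact: val_inj.
  by move: xy; case: (x k'); case: (y k').
rewrite -(mixE d); congr h; apply/ffunP => i.
by rewrite ffunE ltn_ord.
Qed.

(* Averaging over one coordinate keeps the bounded differences and costs
   a factor [expR (2 * c i ^+ 2)]. *)
Lemma bounded_difference_expR (c : 'I_d -> R) h :
    (forall i x, `|h x - h (cflip i x)| <= 2 * c i) ->
  avg (fun x => expR (h x)) <= expR (2 * \sum_i c i ^+ 2 + avg h).
Proof.
(* Induct on a list [s] of the coordinates on which the function may still depend; when it is empty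
   the function is constant. *)
suff H (s : seq 'I_d) h' :
    (forall i x, `|h' x - h' (cflip i x)| <= 2 * c i) ->
    (forall i, i \notin s -> forall x, h' (cflip i x) = h' x) ->
    avg (fun x => expR (h' x)) <= expR (2 * \sum_(i <- s) c i ^+ 2 + avg h').
  by move=> hc; apply: H => // i; rewrite mem_index_enum.
elim: s h' => [|i s IHs] {}h hc hI.
  have x0 : cube d := [ffun=> false].
  have hE x : h x = h x0 by apply: cflip_invariant_cst => i y; apply: hI.
  rewrite big_nil mulr0 add0r (eq_avg hE) avg_cst ?card_cube_gt0//.
  under eq_avg do rewrite hE.
  by rewrite avg_cst ?card_cube_gt0.
pose h' x := (h x + h (cflip i x)) / 2.
have avg_h' : avg h' = avg h.
  under eq_avg do rewrite /h' mulrC.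
  by rewrite avgZl avgD avg_cflip; field.
have h'c j x : `|h' x - h' (cflip j x)| <= 2 * c j.
  rewrite /h' (cflipC i j).
  have := hc j x; have := hc j (cflip i x).
  rewrite !ler_norml => /andP[? ?] /andP[? ?]; apply/andP; split; lra.
have h'I j : j \notin s -> forall x, h' (cflip j x) = h' x.
  move=> js x; rewrite /h' (cflipC i j).
  have [->|ji] := eqVneq j i; first by rewrite cflipK addrC.
  by rewrite !(hI j)// inE negb_or ji.
(* The two values are [h' x + t] and [h' x - t] with [t] bounded by [c i] in absolute value, so the
   factor lost is the hyperbolic cosine of [t]. *)
have step x : (expR (h x) + expR (h (cflip i x))) / 2
              <= expR (2 * c i ^+ 2) * expR (h' x).
  pose t := (h x - h (cflip i x)) / 2.
  have -> : h x = h' x + t by rewrite /h' /t; field.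
  have -> : h (cflip i x) = h' x - t by rewrite /h' /t; field.
  rewrite !expRD -mulrDr -mulrA mulrC ler_wpM2r ?expR_ge0//.
  apply: le_trans (cosh_le_expR t) _; rewrite ler_expR.
  have := hc i x; rewrite ler_norml /t => /andP[? ?]; nra.
have -> : avg (fun x => expR (h x))
        = avg (fun x => (expR (h x) + expR (h (cflip i x))) / 2).
  under [RHS]eq_avg do rewrite mulrC.
  by rewrite avgZl avgD (avg_cflip i (fun x => expR (h x))); field.
apply: le_trans (le_avg step) _; rewrite avgZl.
rewrite big_cons mulrDr -addrA expRD ler_wpM2l ?expR_ge0// -avg_h'.
exact: IHs.
Qed.

(** Every element of the group is its own inverse, so this is also the convolution of [f] with
    itself. For [f = sigma - p] with [sigma] of mean [p], it is the covariance of the edges joining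
    one uniform vertex to two fixed vertices with difference [g]. *)
Definition autocorr f g := avg (fun z => f z * f (cmul z g)).

Lemma avg_autocorr f : avg f = 0 -> avg (autocorr f) = 0.
Proof.
move=> f0; rewrite /autocorr avg_exchange.
rewrite (eq_avg (g := fun=> 0)) ?avg_cst ?card_cube_gt0// => z.
by rewrite avgZl avg_cmul f0 mulr0.
Qed.

(* Writing [D] for the discrete derivative in direction [i], the difference
   is [2 E[Df(z) Df(zg)]], at most [2 E[(Df)^2]] by AM-GM. *)
Lemma autocorr_diff f i g :
  `|autocorr f g - autocorr f (cflip i g)| <= 2 * Inf f i.
Proof.
pose D x := (f x - f (cflip i x)) / 2.
have DE : Inf f i = avg (fun x => D x ^+ 2).
  by rewrite /Inf EcubeE; apply: eq_avg => x; rewrite /D; field.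
have -> : autocorr f g - autocorr f (cflip i g)
        = 2 * avg (fun z => D z * D (cmul z g)).
  have aE : autocorr f g - autocorr f (cflip i g)
      = avg (fun z => 2 * (f z * D (cmul z g))).
    by rewrite -avgB; apply: eq_avg => z; rewrite cmul_cflipr /D; field.
  (* Substituting [cflip i z] for [z] changes the sign of the derivative factor; averaging this form
     with [aE] replaces [f z] by [D z]. *)
  have aE' : autocorr f g - autocorr f (cflip i g)
      = avg (fun z => - (2 * (f (cflip i z) * D (cmul z g)))).
    rewrite aE -(avg_cflip i); apply: eq_avg => z.
    by rewrite cmul_cflipl /D cflipK; field.
  have -> : autocorr f g - autocorr f (cflip i g)
    = 2^-1 * ((autocorr f g - autocorr f (cflip i g)) +
       (autocorr f g - autocorr f (cflip i g))) by field.
  by rewrite {1}aE aE' -avgD -!avgZl; apply: eq_avg => z; rewrite [D z]/D; field.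
(* The signs [e = 1] and [e = -1] give the two sides of the absolute value; translation invariance
   gives [D x] and [D (cmul x g)] the same second moment. *)
have bound (e : R) : e ^+ 2 = 1 ->
    e * avg (fun z => D z * D (cmul z g)) <= avg (fun x => D x ^+ 2).
  move=> e1; rewrite -avgZl.
  have -> : avg (fun x => D x ^+ 2)
          = avg (fun x => 2^-1 * (D x ^+ 2 + D (cmul x g) ^+ 2)).
    by rewrite avgZl avgD (avg_cmulr g (fun x => D x ^+ 2)); field.
  apply: le_avg => x; move: (D x) (D (cmul x g)) => a b.
  have := sqr_ge0 (a - e * b); rewrite sqrrB exprMn e1; lra.
rewrite DE normrM ger0_norm// ler_pM2l//.
have eN : (-1) ^+ 2 = 1 :> R by rewrite sqrrN expr1n.
have := bound 1 (expr1n _ _); have := bound (-1) eN.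
by rewrite mul1r mulN1r lerNl => ? ?; rewrite ler_norml; apply/andP.
Qed.

End Cube.

(** * Rows of the graph and likelihood ratios against G(n, p) *)

Lemma prod_row {R : comNzRingType} {n : nat} (k : 'I_n) (F : 'I_n -> R) :
  \prod_(e : edge n | (val e).2 == k) F (val e).1 = \prod_(i : 'I_n | (i < k)%N) F i.
Proof.
transitivity (\prod_(u : 'I_n * 'I_n | (u.1 < u.2)%N && (u.2 == k)) F u.1).
  rewrite [RHS](reindex_omap (val : edge n -> _) insub) /=; last first.
    by move=> u /andP[uu _]; rewrite insubT.
  by apply: eq_bigl => -[u uu] /=; rewrite uu insubT /= eqxx andbT.
rewrite -(pair_big_dep xpredT (fun i j : 'I_n => (i < j)%N && (j == k))
                       (fun i _ => F i)) /= [RHS]big_mkcond /=.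
apply: eq_bigr => i _; case: ifP => ik.
  rewrite (eq_bigl (pred1 k)) ?big_pred1_eq// => j /=.
  by have [->|] := eqVneq j k; rewrite ?ik ?andbF.
by rewrite big_pred0// => j; have [->|] := eqVneq j k; rewrite ?ik ?andbF.
Qed.

Section LikelihoodRatio.
Context {R : realType} {n d : nat}.
Context (sigma : cube d -> R) (p : R).
Context (sigma01 : forall g, 0 <= sigma g <= 1) (p01 : 0 < p < 1).

Implicit Types (G : graph n) (xs : {ffun 'I_n -> cube d}) (q r : R) (b : bool).

Local Notation src e := ((val e).1).
Local Notation tgt e := ((val e).2).
Local Notation Q := (@ER_pmf R n p).

Lemma bern_gt0 b : 0 < bern p b.
Proof. by case/andP: p01 => ? ?; case: b; rewrite /= ?subr_gt0. Qed.

Lemma ER_pmf_gt0 G : 0 < Q G.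
Proof. by apply: prodr_gt0 => e _; apply: bern_gt0. Qed.

Definition ell q b := bern q b / bern p b.

Lemma mul_bern_ell q b : bern p b * ell q b = bern q b.
Proof. by rewrite mulrC divfK// gt_eqF// bern_gt0. Qed.

Lemma ell_ge0 g b : 0 <= ell (sigma g) b.
Proof.
rewrite divr_ge0 ?(ltW (bern_gt0 b))//.
by case/andP: (sigma01 g) => ? ?; case: b; rewrite /= ?subr_ge0.
Qed.

Lemma sum_bern_ell q : \sum_b bern p b * ell q b = 1.
Proof.
under eq_bigr do rewrite mul_bern_ell.
by rewrite big_bool /= addrCA subrr addr0.
Qed.

(** The function [ell q - 1] is [(q - p) / (p * (1 - p))] times the centred edge indicator, whose
    variance is [p * (1 - p)]. *)
Lemma sum_bern_ellM q r :
  \sum_b bern p b * (ell q b * ell r b) = 1 + (q - p) * (r - p) / (p * (1 - p)).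
Proof.
case/andP: p01 => p0 p1; rewrite big_bool /ell /=; field.
by rewrite subr_eq0 !gt_eqF.
Qed.

(** Under G(n, p) the edges in [B] are independent of the others, so they can be integrated out one
    by one. This is how a whole row is removed. *)
Lemma ER_sum_prod (B : pred (edge n)) (w : edge n -> bool -> R) F :
    (forall G G', (forall e, ~~ B e -> G e = G' e) -> F G = F G') ->
  \sum_G Q G * (F G * \prod_(e | B e) w e (G e))
  = (\sum_G Q G * F G) * \prod_(e | B e) \sum_b bern p b * w e b.
Proof.
move=> FB.
pose a (w : edge n -> bool -> R) G := \prod_(e | B e) (bern p (G e) * w e (G e)).
pose b G := \prod_(e | ~~ B e) bern p (G e) * F G.
have N0 : #|{: graph n}|%:R != 0 :> R.
  by rewrite pnatr_eq0 card_ffun card_bool expn_eq0.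
have ab w' : #|{: graph n}|%:R * (\sum_G a w' G * b G)
             = (\sum_G a w' G) * \sum_G b G.
  apply: (sum_indep (B := B)) => [x y xy|x y xy].
    by apply: eq_bigr => e Be; rewrite xy.
  rewrite /b (FB x y)//; congr (_ * _).
  by apply: eq_bigr => e Be; rewrite xy.
have QE G : Q G = (\prod_(e | B e) bern p (G e)) * \prod_(e | ~~ B e) bern p (G e).
  by rewrite /ER_pmf (bigID B).
(* An edge outside [B] is a free bit and contributes a factor 2, the same for every [w']; it cancels
   when [w] is compared with the constant 1. *)
have sum_a w' : \sum_G a w' G
    = \prod_e (if B e then \sum_b bern p b * w' e b else 2).
  transitivity (\sum_(G : graph n) \prod_e
      (if B e then bern p (G e) * w' e (G e) else 1)).
    by apply: eq_bigr => G _; rewrite /a big_mkcond.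
  rewrite -(bigA_distr_bigA (fun e b =>
      if B e then bern p b * w' e b else 1)).
  by apply: eq_bigr => e _; case: ifP; rewrite // big_bool.
have := ab w; have := ab (fun _ _ => 1).
have -> : \sum_G a (fun _ _ => 1) G * b G = \sum_G Q G * F G.
  apply: eq_bigr => G _; rewrite QE /b mulrA; congr (_ * _ * _).
  by apply: eq_bigr => e _; rewrite mulr1.
have -> : \sum_G a w G * b G
        = \sum_G Q G * (F G * \prod_(e | B e) w e (G e)).
  by apply: eq_bigr => G _; rewrite QE /a /b big_split /=; ring.
have -> : \sum_G a w G = (\sum_G a (fun _ _ => 1) G) *
    \prod_(e | B e) \sum_b bern p b * w e b.
  rewrite !sum_a [X in _ = _ * X]big_mkcond -big_split /=; apply: eq_bigr => e _.
  by case: ifP; rewrite ?mulr1// [X in _ = X * _]big_bool /= !mulr1 addrCA subrr addr0 mul1r.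
rewrite mulrAC => <-; rewrite -mulrA => /(mulfI N0) ->//.
Qed.

Lemma ER_sum1 : \sum_G Q G = 1.
Proof.
rewrite -(bigA_distr_bigA (fun=> bern p)) big1// => e _.
by rewrite big_bool /= addrCA subrr addr0.
Qed.

Definition prefix_lr (k : nat) xs G :=
  \prod_(e : edge n | (tgt e < k)%N)
     ell (sigma (cmul (xs (src e)) (xs (tgt e)))) (G e).

(** The position [z] of vertex [k] is kept apart from [xs], so that it can be averaged, or
    duplicated, with the other points fixed. *)
Definition row_lr (k : 'I_n) xs z G :=
  \prod_(e : edge n | tgt e == k) ell (sigma (cmul (xs (src e)) z)) (G e).

(** Averaging over all [n] points gives every [k] the same sample space; [prefix_lr k] reads only
    the points with index below [k]. At [k = n] this is the density of the random geometric
    model. *)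
Definition lr (k : nat) G := avg (fun xs => prefix_lr k xs G).

Lemma prefix_lr_ge0 k xs G : 0 <= prefix_lr k xs G.
Proof. by apply: prodr_ge0 => e _; apply: ell_ge0. Qed.

Lemma lr_ge0 k G : 0 <= lr k G.
Proof. by apply: avg_ge0 => xs; apply: prefix_lr_ge0. Qed.

Lemma prefix_lrS (k : 'I_n) xs G :
  prefix_lr k.+1 xs G = prefix_lr k xs G * row_lr k xs (xs k) G.
Proof.
rewrite /prefix_lr (bigID (fun e : edge n => (tgt e < k)%N)) /=; congr (_ * _).
  apply: eq_bigl => e; rewrite andb_idl// => /ltnW; by rewrite ltnS.
rewrite [LHS](eq_bigl (fun e : edge n => tgt e == k)); last first.
  by move=> e; rewrite -leqNgt ltnS -eqn_leq.
by apply: eq_bigr => e /eqP ->.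
Qed.

Lemma prefix_lr_local (k : 'I_n) xs G G' :
  (forall e : edge n, tgt e != k -> G e = G' e) ->
  prefix_lr k xs G = prefix_lr k xs G'.
Proof.
move=> GG; apply: eq_bigr => e ek; rewrite GG//.
by apply: contraTN ek => /eqP ->; rewrite ltnn.
Qed.

Lemma lr_local (k : 'I_n) G G' :
  (forall e : edge n, tgt e != k -> G e = G' e) -> lr k G = lr k G'.
Proof. by move=> GG; apply: eq_avg => xs; apply: prefix_lr_local. Qed.

Lemma card_points_gt0 : (0 < #|{: {ffun 'I_n -> cube d}}|)%N.
Proof. by rewrite card_ffun expn_gt0 card_cube_gt0. Qed.

Lemma sum_prefix_lr k xs : \sum_G Q G * prefix_lr k xs G = 1.
Proof.
have := ER_sum_prod (B := fun e => (tgt e < k)%N) (F := fun=> 1)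
  (fun e => ell (sigma (cmul (xs (src e)) (xs (tgt e))))) (fun _ _ _ => erefl).
rewrite [X in _ = _ * X]big1; last by move=> e _; apply: sum_bern_ell.
under eq_bigr do rewrite mul1r.
by move=> ->; under eq_bigr do rewrite mulr1; rewrite ER_sum1 mulr1.
Qed.

Lemma sum_lr k : \sum_G Q G * lr k G = 1.
Proof.
under eq_bigr do rewrite -avgZl.
rewrite avg_sum; under eq_avg do rewrite sum_prefix_lr.
by rewrite avg_cst// card_points_gt0.
Qed.

Lemma RAG_pmfE G : RAG_pmf sigma G = Q G * lr n G.
Proof.
rewrite /RAG_pmf -avgZl /avg card_ffun card_cube card_ord !natrX.
congr (_ * _); apply: eq_bigr => xs _; rewrite /ER_pmf /prefix_lr.
rewrite [X in _ = _ * X](eq_bigl xpredT); last by move=> e; rewrite ltn_ord.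
by rewrite -big_split /=; apply: eq_bigr => e _; rewrite mul_bern_ell.
Qed.

(** * Relative entropy and its control of total variation *)

Definition entropy k := \sum_G Q G * (lr k G * ln (lr k G)).

(* The left-hand side is the squared Hellinger distance. *)
Lemma hellinger_le_entropy k :
  \sum_G Q G * (Num.sqrt (lr k G) - 1) ^+ 2 <= entropy k.
Proof.
have -> : \sum_G Q G * (Num.sqrt (lr k G) - 1) ^+ 2
        = \sum_G Q G * (2 * (lr k G - Num.sqrt (lr k G))).
  apply/eqP; rewrite -subr_eq0 -sumrB; apply/eqP.
  transitivity (\sum_G (Q G - Q G * lr k G)); last first.
    by rewrite sumrB ER_sum1 sum_lr subrr.
  apply: eq_bigr => G _; have := sqr_sqrtr (lr_ge0 k G).
  by move: (Num.sqrt _) => s <-; ring.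
apply: ler_sum => G _; rewrite ler_wpM2l ?(ltW (ER_pmf_gt0 G))//.
exact/sub_sqrt_le_mul_ln/lr_ge0.
Qed.

(** With [s] the square root of [lr n], factor [lr n - 1] as [(s - 1) * (s + 1)]. The first factor
    gives the Hellinger sum [H], and the second has second moment at most 4. *)
Lemma TV_sqr_le_entropy : TV (@RAG_pmf R n d sigma) Q ^+ 2 <= entropy n.
Proof.
apply: le_trans (hellinger_le_entropy n).
pose s G := Num.sqrt (lr n G).
have s0 G : 0 <= s G by apply: sqrtr_ge0.
have sE G : s G ^+ 2 = lr n G by rewrite sqr_sqrtr ?lr_ge0.
set H := \sum_G _.
set S := \sum_G `|RAG_pmf sigma G - Q G|.
have H0 : 0 <= H by apply: sumr_ge0 => G _; rewrite mulr_ge0 ?sqr_ge0 ?ltW ?ER_pmf_gt0.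
have S4 : \sum_G Q G * (s G + 1) ^+ 2 <= 4.
  have -> : 4 = \sum_G Q G * (2 * (s G ^+ 2 + 1)).
    under eq_bigr do rewrite sE mulrCA mulrDr mulr1.
    by rewrite -mulr_sumr big_split /= sum_lr ER_sum1; ring.
  apply: ler_sum => G _; rewrite ler_wpM2l ?(ltW (ER_pmf_gt0 G))//.
  have := sqr_ge0 (s G - 1); nra.
(* AM-GM with a free parameter replaces Cauchy-Schwarz. *)
have amgm (t : R) : 0 < t -> 2 * t * S <= t ^+ 2 * 4 + H.
  move=> t0; apply: (@le_trans _ _
     (\sum_G (t ^+ 2 * (Q G * (s G + 1) ^+ 2) + Q G * (s G - 1) ^+ 2))); last first.
    by rewrite big_split /= -mulr_sumr lerD2r ler_wpM2l ?sqr_ge0.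
  rewrite /S mulr_sumr; apply: ler_sum => G _.
  rewrite RAG_pmfE -{2}[Q G]mulr1 -mulrBr normrM gtr0_norm ?ER_pmf_gt0//.
  have -> : lr n G - 1 = (s G - 1) * (s G + 1) by rewrite -sE; ring.
  rewrite normrM (ger0_norm (addr_ge0 (s0 G) ler01)).
  have := sqr_ge0 (t * (s G + 1) - `|s G - 1|).
  rewrite sqrrB exprMn real_normK ?num_real// => sq.
  have := mulr_ge0 (ltW (ER_pmf_gt0 G)) sq; lra.
have S0 : 0 <= S by apply: sumr_ge0.
rewrite /TV -/S exprMn.
have [->|SN0] := eqVneq S 0; first by rewrite expr0n mulr0.
have S_gt0 : 0 < S by rewrite lt_def SN0.
(* This [t] maximizes [2 * t * S - 4 * t ^+ 2]; the maximum [S ^+ 2 / 4] is the squared total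
   variation. *)
have := amgm (S / 4) ltac:(lra); lra.
Qed.

(** * Entropy increment of one row *)

Definition row_lr_mean (k : 'I_n) xs G := avg (fun z => row_lr k xs z G).

(** Up to the factor [lr k G], this is the posterior mean, given the earlier rows, of the squared
    ratio of row [k]. *)
Definition row_second_moment (k : 'I_n) G :=
  avg (fun xs => prefix_lr k xs G * row_lr_mean k xs G ^+ 2).

(** Every edge has its smaller endpoint first, so the rows before [k] do not involve the point of
    vertex [k], and row [k] involves it only through [z]. Resampling that point averages the row
    alone. *)
Lemma lrS (k : 'I_n) G :
  lr k.+1 G = avg (fun xs => prefix_lr k xs G * row_lr_mean k xs G).
Proof.
rewrite /lr (avg_upd k) ?card_cube_gt0//; apply: eq_avg => xs.
rewrite -avgZl; apply: eq_avg => z; rewrite prefix_lrS ffunE eqxx.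
congr (_ * _); apply: eq_bigr => e ek; rewrite !ffunE.
  have : (src e < tgt e)%N := valP e; move=> lt_e.
  rewrite !ifN_eq// -val_eqE ltn_eqF//; exact: ltn_trans lt_e ek.
have : (src e < tgt e)%N := valP e; rewrite (eqP ek) => lt_e.
by rewrite ifN_eq// -val_eqE ltn_eqF.
Qed.

Lemma lrS_sqr_le (k : 'I_n) G :
  lr k.+1 G ^+ 2 <= lr k G * row_second_moment k G.
Proof. by rewrite lrS; apply: sqr_avgM_le => xs; apply: prefix_lr_ge0. Qed.

Lemma row_second_moment_ge0 (k : 'I_n) G : 0 <= row_second_moment k G.
Proof. by apply: avg_ge0 => xs; rewrite mulr_ge0 ?prefix_lr_ge0 ?sqr_ge0. Qed.

(* Row [k] integrates to one given the points, so the log-likelihood of the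
   earlier rows has the same mean under both laws. *)
Lemma sum_lrS_ln (k : 'I_n) :
  \sum_G Q G * (lr k.+1 G * ln (lr k G)) = entropy k.
Proof.
rewrite /entropy.
transitivity (avg (fun xs => \sum_G Q G * (prefix_lr k xs G * ln (lr k G)))).
  rewrite -[RHS](eq_avg (f := fun xs => \sum_G Q G *
    (prefix_lr k xs G * ln (lr k G) * row_lr k xs (xs k) G))); last first.
    move=> xs; rewrite (ER_sum_prod (B := fun e => tgt e == k)
      (F := fun G => prefix_lr k xs G * ln (lr k G))
      (fun e => ell (sigma (cmul (xs (src e)) (xs k))))).
      by rewrite [X in _ * X]big1 ?mulr1// => e _; apply: sum_bern_ell.
    by move=> G G' GG; rewrite (prefix_lr_local _ GG) (lr_local GG).
  rewrite -avg_sum; apply: eq_bigr => G _.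
  set l := ln _; rewrite mulrCA mulrC /lr -avgZl; apply: eq_avg => xs.
  by rewrite prefix_lrS; ring.
rewrite -avg_sum; apply: eq_bigr => G _.
by set l := ln _; rewrite mulrCA mulrC /lr -avgZl; apply: eq_avg => xs; ring.
Qed.

(** Write the new ratio as [l' = l * t]. The tangent bound on [ln t] costs [l' * t], which is
    [l' ^+ 2 / l] and hence at most the second moment. In total the increment is at most
    [expR (- a) * expR a + a - 1 = a]. *)
Lemma entropyS (k : 'I_n) (a : R) :
  \sum_G Q G * row_second_moment k G <= expR a ->
  entropy k.+1 <= entropy k + a.
Proof.
move=> Ma.
have pt G : lr k.+1 G * ln (lr k.+1 G) <=
    lr k.+1 G * ln (lr k G) + expR (- a) * row_second_moment k G
    + (a - 1) * lr k.+1 G.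
  have := lrS_sqr_le k G; have := row_second_moment_ge0 k G.
  have := lr_ge0 k G; have := lr_ge0 k.+1 G.
  move: (lr k.+1 G) (lr k G) (row_second_moment k G) => l' l m.
  rewrite le_eqVlt => /predU1P[<- _ m0 _|l'0 l0 m0 lm].
    by rewrite !mul0r mulr0 add0r addr0 mulr_ge0 ?expR_ge0.
  (* Division by [l] is legitimate: if [l] vanished, the Cauchy-Schwarz bound would force [l'] to
     vanish too. *)
  have {}l0 : 0 < l.
    rewrite lt_def l0 andbT; apply: contraTneq lm => ->.
    by rewrite mul0r -ltNge exprn_gt0.
  have l'E : l' = l * (l' / l) by rewrite mulrC divfK// gt_eqF.
  rewrite {2}l'E lnM ?posrE ?divr_gt0// mulrDr -addrA lerD2l.
  have := ln_le_expR a (divr_gt0 l'0 l0); rewrite -(ler_pM2l l'0) => /le_trans; apply.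
  have : l' * (l' / l) <= m by rewrite mulrA -expr2 ler_pdivrMr// mulrC.
  move=> /(ler_wpM2l (expR_ge0 (- a))).
  by move: (l' / l) (expR _) => t e; lra.
apply: (@le_trans _ _ (\sum_G (Q G * (lr k.+1 G * ln (lr k G)) +
   expR (- a) * (Q G * row_second_moment k G) + (a - 1) * (Q G * lr k.+1 G)))).
  apply: ler_sum => G _; have := ler_wpM2l (ltW (ER_pmf_gt0 G)) (pt G).
  by rewrite !mulrDr; lra.
rewrite !big_split /= sum_lrS_ln -!mulr_sumr sum_lr.
have : expR (- a) * \sum_G Q G * row_second_moment k G <= 1.
  by rewrite expRN ler_pdivrMl ?expR_gt0// mulr1.
lra.
Qed.

Local Notation gamma := (autocorr (fun g => sigma g - p)).

(** Squaring the row mean creates two independent positions [z] and [z'] for vertex [k]. Integrating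
    out row [k], then the earlier rows, leaves a product over the [k] earlier points; these are
    independent, and each contributes the same factor. *)
Lemma sum_row_second_moment (k : 'I_n) :
  \sum_G Q G * row_second_moment k G
  = avg (fun z => avg (fun z' => (1 + gamma (cmul z z') / (p * (1 - p))) ^+ k)).
Proof.
pose phi z z' y :=
  \sum_b bern p b * (ell (sigma (cmul y z)) b * ell (sigma (cmul y z')) b).
have phiE z z' : avg (phi z z') = 1 + gamma (cmul z z') / (p * (1 - p)).
  rewrite /phi; under eq_avg do rewrite sum_bern_ellM mulrC.
  rewrite avgD avg_cst ?card_cube_gt0// avgZl [in RHS]mulrC; congr (_ + _ * _).
  rewrite /autocorr -[RHS](avg_cmulr z); apply: eq_avg => y.
  by rewrite -cmulA cmulK.
transitivity (avg (fun xs => avg (fun z => avg (fun z' =>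
    \prod_(i : 'I_n | (i < k)%N) phi z z' (xs i))))).
  rewrite /row_second_moment; under eq_bigr do rewrite -avgZl.
  rewrite avg_sum; apply: eq_avg => xs.
  transitivity (\sum_G avg (fun z => avg (fun z' =>
      Q G * (prefix_lr k xs G * (row_lr k xs z G * row_lr k xs z' G))))).
    apply: eq_bigr => G _; rewrite mulrA expr2 mulrA -avgZl.
    apply: eq_avg => z; rewrite mulrAC -avgZl.
    by apply: eq_avg => z'; ring.
  rewrite avg_sum; apply: eq_avg => z; rewrite avg_sum; apply: eq_avg => z'.
  rewrite -(prod_row k (phi z z' \o xs)) /=.
  under eq_bigr do rewrite -big_split /=.
  rewrite (ER_sum_prod (B := fun e => tgt e == k) (F := prefix_lr k xs)
    (fun e b => ell (sigma (cmul (xs (src e)) z)) b *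
                ell (sigma (cmul (xs (src e)) z')) b)).
    by rewrite sum_prefix_lr mul1r.
  by move=> G G' GG; apply: prefix_lr_local.
rewrite [LHS]avg_exchange; apply: eq_avg => z; rewrite [LHS]avg_exchange.
apply: eq_avg => z'; rewrite -phiE.
transitivity (\prod_(i < n) avg (fun y => if (i < k)%N then phi z z' y else 1)).
  by rewrite -avg_prod; apply: eq_avg => xs; rewrite big_mkcond.
transitivity (\prod_(i < n | (i < k)%N) avg (phi z z')).
  rewrite [RHS]big_mkcond; apply: eq_bigr => i _.
  by case: ifP => // _; rewrite avg_cst ?card_cube_gt0.
by rewrite -(big_ord_widen_cond n xpredT (fun=> avg (phi z z'))
  (ltnW (ltn_ord k))) prodr_const card_ord.
Qed.

Lemma row_second_moment_le (k : 'I_n) : Ecube sigma = p ->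
  \sum_G Q G * row_second_moment k G <=
  expR (2 * (k%:R / (p * (1 - p))) ^+ 2 * \sum_i Inf sigma i ^+ 2).
Proof.
move=> sigma_p; case/andP: p01 => p0 p1.
set s := p * (1 - p); have s0 : 0 < s by rewrite mulr_gt0 ?subr_gt0.
pose f g := sigma g - p.
have f_avg : avg f = 0.
  by rewrite /f avgB avg_cst ?card_cube_gt0// -EcubeE sigma_p subrr.
have InfE i : Inf f i = Inf sigma i.
  by rewrite /Inf !EcubeE; apply: eq_avg => x; congr (_ ^+ 2 / _); rewrite /f; ring.
(* Nonnegativity of the base is what lets [1 + x <= expR x] be raised to the power [k]. It holds
   because the base is an average of products of likelihood ratios. *)
have gamma_ge g : 0 <= 1 + gamma g / s.
  have -> : 1 + gamma g / s = avg (fun z => 1 + f z * f (cmul z g) / s).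
    rewrite avgD avg_cst ?card_cube_gt0//; congr (_ + _).
    by under [RHS]eq_avg do rewrite mulrC; rewrite avgZl mulrC.
  apply: avg_ge0 => z; rewrite -sum_bern_ellM; apply: sumr_ge0 => b _.
  by apply: mulr_ge0 (ltW (bern_gt0 b)) (mulr_ge0 (ell_ge0 _ _) (ell_ge0 _ _)).
pose lam := k%:R / s; have lam0 : 0 <= lam by rewrite divr_ge0 ?ler0n ?ltW.
rewrite sum_row_second_moment -/s.
apply: (@le_trans _ _ (avg (fun g => expR (lam * gamma g)))).
  rewrite -[leRHS](avg_cst (T := cube d)) ?card_cube_gt0//.
  (* For fixed [z] the product [cmul z z'] is uniform, so the double average becomes a single
     average over the difference. *)
  apply: le_avg => z; rewrite -[leRHS](avg_cmul z); apply: le_avg => z'.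
  rewrite /lam -mulrA expRM_natl [s^-1 * _]mulrC.
  by rewrite lerXn2r ?nnegrE ?gamma_ge ?expR_ge0// expR_ge1Dx.
apply: le_trans (bounded_difference_expR (c := fun i => lam * Inf sigma i) _) _.
  move=> i g; rewrite -mulrBr normrM (ger0_norm lam0) mulrCA ler_wpM2l//.
  by rewrite -InfE; apply: autocorr_diff.
rewrite avgZl avg_autocorr// mulr0 addr0.
under eq_bigr do rewrite exprMn.
by rewrite -mulr_sumr mulrA.
Qed.

End LikelihoodRatio.

(** * Summation over the rows *)

Theorem theorem1p11 :
  forall R : realType, exists C : R, 0 < C /\
  forall (d n : nat) (sigma : cube d -> R) (p : R),
    (forall g, 0 <= sigma g <= 1) ->
    (forall g, sigma g = sigma (cneg g)) ->
    Ecube sigma = p -> 0 < p < 1 ->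
    TV (@RAG_pmf R n d sigma) (@ER_pmf R n p) ^+ 2 <=
      C * ((n%:R ^+ 3 * \sum_(i < d) Inf sigma i ^+ 2) /
           (p ^+ 2 * (1 - p) ^+ 2)).
Proof.
move=> R; exists 2; split=> // d n sigma p sigma01 _ sigma_p p01.
have /andP[p0 p1] := p01.
apply: le_trans (TV_sqr_le_entropy sigma01 p01) _.
set V := \sum_(i < d) _; set s := p * (1 - p).
have V0 : 0 <= V by apply: sumr_ge0 => i _; apply: sqr_ge0.
have s0 : 0 < s by rewrite mulr_gt0 ?subr_gt0.
(* Bounding [k] by [n] in every row gives one increment [a] for all rows; [n] of them produce the
   cube of [n] and the constant 2. *)
pose a : R := 2 * (n%:R / s) ^+ 2 * V.
have step k : (k <= n)%N -> entropy (n := n) sigma p k <= k%:R * a.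
  elim: k => [_|k IHk kn].
    rewrite mul0r /entropy big1// => G _.
    have -> : lr sigma p 0 G = 1.
      rewrite /lr -[RHS](avg_cst (T := {ffun 'I_n -> cube d})) ?card_points_gt0//.
      by apply: eq_avg => xs; rewrite /prefix_lr big_pred0.
    by rewrite ln1 mulr0 mulr0.
  rewrite -natr1 mulrDl mul1r; apply: (@le_trans _ _ (entropy (n := n) sigma p k + a)).
    apply: (entropyS sigma01 p01 (k := Ordinal kn)).
    apply: le_trans (row_second_moment_le _ _ _ _) _ => //.
    rewrite ler_expR ler_wpM2r// ler_wpM2l// lerXn2r ?nnegrE ?divr_ge0 ?ler0n ?(ltW s0)//.
    by rewrite -/s ler_pM2r ?invr_gt0// ler_nat ltnW.
  by rewrite lerD2r IHk// ltnW.
apply: le_trans (step n (leqnn n)) _; rewrite /a /s le_eqVlt; apply/orP; left.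
by apply/eqP; field; rewrite subr_eq0 !gt_eqF.
Qed.
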